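(* Let $X,Y\subseteq\mathsf{all}$ be such that $X\neq\emptyset$ and for all $x\in X$ there is $y\in Y$ with $y\ne x$. Suppose that at least one of the following holds: \begin{itemize} \item ($0\in X$ or $1\in X$) and $\mathsf{osc}\notin Y$; \item $\mathsf{osc}\in X$ and ($0\notin Y$ or $1\notin Y$). \end{itemize} Then $(\mathfrak c,[\mathfrak c]^{\aleph_0},\in)\le_T(D_X,\mathrm{Sym}(\omega),R_Y)$.
   Context: Relational systems: a relational system is a triple $\mathcal A=(A_-,A_+,A)$ with $A\subseteq A_-\times A_+$ such that for every $a_-\in A_-$ there is $a_+\in A_+$ with $a_-\,A\,a_+$, and for every $a_+\in A_+$ there is $a_-\in A_-$ for which $a_-\,A\,a_+$ fails. $\mathcal A\le_T\mathcal B$ (Tukey reducibility), for $\mathcal B=(B_-,B_+,B)$, means that there are functions $\varphi_-:A_-\to B_-$ and $\varphi_+:B_+\to A_+$ such that for all $a_-\in A_-$, $b_+\in B_+$: $\varphi_-(a_-)\,B\,b_+$ implies $a_-\,A\,\varphi_+(b_+)$. Density: $n\in\omega$ is identified with $\{0,\dots,n-1\}$. For $A\subseteq\omega$, $\underline d(A)=\liminf_n|A\cap n|/n$ and $\overline d(A)=\limsup_n|A\cap n|/n$; if they are equal, $d(A)$ denotes the common value; if $\underline d(A)<\overline d(A)$, write $d(A)=\mathsf{osc}$, where $\mathsf{osc}$ is a formal symbol. $\mathsf{all}=[0,1]\cup\{\mathsf{osc}\}$. $\mathrm{Sym}(\omega)$ is the set of permutations of $\omega$. $D_X$ is the collection of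 infinite-coinfinite sets $A\subseteq\omega$ with $d(A)\in X$. For $A\in D_X$ and $\pi\in\mathrm{Sym}(\omega)$, $A\,R_Y\,\pi$ means $d(\pi[A])\in Y$ and $d(\pi[A])\ne d(A)$. $\mathfrak c=2^{\aleph_0}$, and $[\mathfrak c]^{\aleph_0}$ is the set of countable subsets of $\mathfrak c$; in $(\mathfrak c,[\mathfrak c]^{\aleph_0},\in)$, $\alpha$ is related to $C$ iff $\alpha\in C$. *)

(* Defs.v *)
From HB Require Import structures.
From mathcomp Require Import all_boot all_order all_algebra.
From mathcomp Require Import finmap.
From mathcomp Require Import all_classical all_reals all_analysis.

Set Implicit Arguments.
Unset Strict Implicit.
Unset Printing Implicit Defensive.

Import Order.TTheory GRing.Theory Num.Theory.
Import numFieldNormedType.Exports.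
Local Open Scope classical_set_scope.
Local Open Scope ring_scope.

Record triple := Triple {
  chal : Type;
  resp : Type;
  meets : chal -> resp -> Prop }.

Definition relational_system (A : triple) : Prop :=
  (forall a : chal A, exists b : resp A, meets a b) /\
  (forall b : resp A, exists a : chal A, ~ meets a b).

(* Tukey reducibility is a relation between relational systems only, so the
   two defining conditions of a relational system are part of it. *)
Definition tukey_le (A B : triple) : Prop :=
  [/\ relational_system A, relational_system B &
      exists (f : chal A -> chal B) (g : resp B -> resp A),
        forall (a : chal A) (b : resp B), meets (f a) b -> meets a (g b)].

(* (K, [K]^{aleph_0}, \in); here "countable" includes the finite sets. *)
Definition mem_countable (K : Type) : triple :=
  @Triple K {C : set K | countable C} (fun a C => sval C a).

Section Density.
Variable R : realType.

Definition initial_ratio (A : set nat) (n : nat) : R :=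
  (#|` fset_set (A `&` `I_n)|)%fset%:R / n%:R.

Definition lower_density (A : set nat) : R := limn_inf (initial_ratio A).

Definition upper_density (A : set nat) : R := limn_sup (initial_ratio A).

Inductive dvalue := dreal of R | osc.

(* [0,1] together with the formal symbol osc *)
Definition all_dvalues : set dvalue :=
  [set z | z = osc \/ exists2 r : R, 0 <= r <= 1 & z = dreal r].

Definition density (A : set nat) : dvalue :=
  if lower_density A < upper_density A then osc else dreal (lower_density A).

Definition inf_coinf (A : set nat) : Prop :=
  infinite_set A /\ infinite_set (~` A).

Definition Sym := {p : nat -> nat | bijective p}.

Definition density_system (X Y : set dvalue) : triple :=
  @Triple {A : set nat | inf_coinf A /\ X (density A)} Sym
    (fun A p => Y (density (sval p @` sval A)) /\
                density (sval p @` sval A) <> density (sval A)).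

End Density.

Arguments osc {R}.

(* Main.v *)
Require Import Defs.
From HB Require Import structures.
From mathcomp Require Import all_boot all_order all_algebra.
From mathcomp Require Import finmap.
From mathcomp Require Import all_classical all_reals all_analysis.
From mathcomp Require Import zify ring lra.

Import Order.TTheory GRing.Theory Num.Theory.
Import numFieldNormedType.Exports.
Local Open Scope classical_set_scope.
Local Open Scope card_scope.
Local Open Scope ring_scope.

(** The relation to be reduced compares reals with countable sets, so the
proof produces continuum many challenges [F a], indexed by the subsets [a] of
the naturals, such that each permutation [p] succeeds on only countably many of
them.  The reduction then sends the [a]-th point to [F a] and [p] to the
countable set of points on which it succeeds.

Such an [F] comes from an almost disjoint family, one whose members meet
pairwise in finite sets.  A permutation preserves almost disjointness, and
densities of almost disjoint sets add up ([cvg_ratioU]), so at most [m] of the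
images can have a density of at least [1 / m]: only countably many images have a
real nonzero density ([countable_real_density]).  It remains to make sure that
any success of [p] on [F a] produces a real nonzero density.
- If 0 is in [X] and osc is not in [Y], let every [F a] have density 0: a
  success must change the density, and it cannot produce osc.
- If osc is in [X] and 0 is not in [Y], let every [F a] have no density: a
  success must produce a density, and it cannot produce 0.
Both families are built from the branches of the binary tree ([branch]): the
first by spreading a branch over the squares ([squares_of]), the second by
filling the dyadic blocks, from [2 ^ k] to [2 ^ k.+1 - 1], with [k] in the
branch ([log_blocks]).  The two remaining cases, with 1 in place of 0, follow by
complementation, which turns the density [r] into [1 - r] ([countably_metC]).

A Tukey reduction also requires both triples to be relational systems.  Every
challenge can be answered: [Y] has a value other than the density of the
challenge, each value in [0,1] and osc is the density of some infinite coinfinite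
set ([density_realized]), and a permutation can move any infinite coinfinite set
onto any other ([inf_coinf_image]).  No permutation answers every challenge since
it succeeds on only countably many [F a]. *)

(** * Initial counts *)

Section Counting.
Implicit Types A B : set nat.

Definition initial_count A (n : nat) : nat :=
  (#|` fset_set (A `&` `I_n)|)%fset.

Lemma initial_countS A n :
  initial_count A n.+1 = (initial_count A n + `[< A n >])%N.
Proof.
rewrite /initial_count IIS setIUr fset_setU; [|exact: finite_setIr..].
case: asboolP => [An|nAn].
  have -> : A `&` [set n] = [set n].
    by apply/seteqP; split => x [] // ->.
  rewrite fset_set1 fsetUC cardfsU1 in_fset_set; last exact: finite_setIr.
  rewrite addnC; congr (_ + nat_of_bool _)%N.
  by apply/negP; rewrite inE => -[_ /=]; rewrite ltnn.
have -> : A `&` [set n] = set0.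
  by apply/seteqP; split => x // [Ax xn]; rewrite xn in Ax.
by rewrite fset_set0 fsetU0 addn0.
Qed.

Lemma initial_count0 A : initial_count A 0 = 0%N.
Proof. by rewrite /initial_count II0 setI0 fset_set0 cardfs0. Qed.

Lemma initial_count_leq A n : (initial_count A n <= n)%N.
Proof.
elim: n => [|n IHn]; first by rewrite initial_count0.
by rewrite initial_countS -addn1 leq_add// leq_b1.
Qed.

Lemma initial_countC A n : (initial_count A n + initial_count (~` A) n = n)%N.
Proof.
elim: n => [|n IHn]; first by rewrite !initial_count0.
by rewrite !initial_countS asbool_neg; case: asboolP => _ /=; lia.
Qed.

Lemma initial_countUI A B n :
  (initial_count (A `|` B) n + initial_count (A `&` B) n =
   initial_count A n + initial_count B n)%N.
Proof.
elim: n => [|n IHn]; first by rewrite !initial_count0.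
rewrite !initial_countS asbool_or asbool_and.
by case: `[< A n >]; case: `[< B n >] => /=; lia.
Qed.

Lemma initial_count_image A (f : nat -> nat) n k :
  A `&` `I_n `<=` f @` `I_k -> (initial_count A n <= k)%N.
Proof.
move=> Ak; apply: geq_card_fset_set; apply: card_le_trans (card_image_le f `I_k).
exact: subset_card_le.
Qed.
End Counting.

(** * Densities as limits *)

(** The sequence is squeezed between its [infs] and [sups], which converge to
[limn_inf u] and [limn_sup u] because they are monotone and bounded. *)
Lemma bounded_cvg_limn_inf (R : realType) (u : R^nat) :
  bounded_fun u -> limn_sup u <= limn_inf u -> u @ \oo --> limn_inf u.
Proof.
move=> bu le_si.
have ub := bounded_fun_has_ubound bu; have lb := bounded_fun_has_lbound bu.
have ci : infs u @ \oo --> limn_inf u.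
  by rewrite limn_infE//; exact: cvg_infs_sup.
have cs : sups u @ \oo --> limn_sup u.
  by rewrite limn_supE//; exact: cvg_sups_inf.
have le_is n : infs u n <= u n <= sups u n.
  apply/andP; split.
    by apply: ge_inf; [exact: has_lbound_sdrop|exists n => /=].
  by apply: ub_le_sup; [exact: has_ubound_sdrop|exists n => /=].
have ge_si : limn_inf u <= limn_sup u.
  apply: ler_cvg_to ci cs _.
  by apply: nearW => n; case/andP: (le_is n); exact: le_trans.
have is_eq : limn_sup u = limn_inf u by apply/eqP; rewrite eq_le le_si.
by apply: squeeze_cvgr ci _; [exact: nearW|rewrite -is_eq].
Qed.

Section Convergence.
Variable R : realType.
Implicit Types (A B : set nat) (r s : R).
Local Notation ratio := (@initial_ratio R).

Lemma ratioE A n : ratio A n = (initial_count A n)%:R / n%:R.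
Proof. by []. Qed.

Lemma ratio_ge0 A n : 0 <= ratio A n.
Proof. by rewrite ratioE divr_ge0. Qed.

Lemma ratio_le1 A n : ratio A n <= 1.
Proof.
rewrite ratioE; case: n => [|n]; first by rewrite invr0 mulr0.
by rewrite ler_pdivrMr ?ltr0n// mul1r ler_nat initial_count_leq.
Qed.

(** Asking for an error below [(n + C) / m] for each [m], instead of one below
[e * n] from some rank on, lets each density be checked by a single bound on
natural numbers. *)
Lemma cvg_ratioP A r :
  (forall m : nat, exists C : R, forall n : nat,
     `|(initial_count A n)%:R - n%:R * r| * m%:R <= n%:R + C) ->
  ratio A @ \oo --> r.
Proof.
move=> H; apply/cvgrPdist_le => e e0.
(* With [n >= C] the error is at most [2 * n / m], hence the choice of [m]. *)
have [m m0 me] : exists2 m : nat, (0 < m)%N & 2 / e <= m%:R.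
  exists (Num.truncn (2 / e)).+1 => //.
  by apply/ltW/truncnS_gt.
have [C HC] := H m.
near=> n.
have n0 : (0 < n)%N by near: n; exact: nbhs_infty_gt.
have nC : C <= n%:R.
  by near: n; exact: nbhs_infty_ger.
have n0' : 0 < n%:R :> R by rewrite ltr0n.
have m0' : 0 < m%:R :> R by rewrite ltr0n.
have -> : r - ratio A n = - ((initial_count A n)%:R - n%:R * r) / n%:R.
  by rewrite ratioE; field; rewrite gt_eqF.
rewrite normrM normrN normfV (gtr0_norm n0') ler_pdivrMr//.
rewrite -(ler_pM2r m0'); apply: le_trans (HC n) _.
rewrite ler_pdivrMr// in me.
nra.
Unshelve. all: by end_near. Qed.

Lemma cvg_ratio_finite A : finite_set A -> ratio A @ \oo --> (0 : R).
Proof.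
move=> fA; apply: cvg_ratioP => m.
have [c cA] : exists c, forall n, (initial_count A n <= c)%N.
  exists #|` fset_set A|%fset => n.
  by apply/fsubset_leq_card; rewrite -fset_set_sub//; exact: finite_setIr.
exists (c * m)%:R => n.
rewrite mulr0 subr0 ger0_norm// -natrM -natrD ler_nat.
by rewrite (leq_trans _ (leq_addl _ _))// leq_mul2r cA orbT.
Qed.

Lemma cvg_ratioC A r : ratio A @ \oo --> r -> ratio (~` A) @ \oo --> 1 - r.
Proof.
move=> Ar; have : (fun n => 1 - ratio A n) @ \oo --> 1 - r.
  by apply: cvgB => //; exact: cvg_cst.
apply: cvg_trans; apply: near_eq_cvg; near=> n.
have n0 : (0 < n)%N by near: n; exact: nbhs_infty_gt.
have n0' : n%:R != 0 :> R by rewrite pnatr_eq0 -lt0n.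
rewrite !ratioE -{1}(divff n0') -mulrBl; congr (_ / _).
by rewrite -{1}(initial_countC A n) natrD addrC addKr.
Unshelve. all: by end_near. Qed.

Lemma cvg_ratioU A B r s : finite_set (A `&` B) ->
  ratio A @ \oo --> r -> ratio B @ \oo --> s -> ratio (A `|` B) @ \oo --> r + s.
Proof.
move=> /cvg_ratio_finite cI Ar Bs.
have : (ratio A \+ ratio B \- ratio (A `&` B)) @ \oo --> r + s - 0.
  by apply: cvgB => //; exact: cvgD.
rewrite subr0; apply: cvg_trans; apply: near_eq_cvg; apply: nearW => n /=.
rewrite !ratioE -mulrDl -mulrBl; congr (_ / _).
by rewrite -natrD -initial_countUI natrD addrK.
Qed.

Lemma cvg_ratio_le1 A r : ratio A @ \oo --> r -> r <= 1.
Proof. by move=> Ar; apply: (cvgr_to_le Ar); apply: nearW; exact: ratio_le1. Qed.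

Lemma cvg_ratio_ge0 A r : ratio A @ \oo --> r -> 0 <= r.
Proof. by move=> Ar; apply: (cvgr_to_ge Ar); apply: nearW; exact: ratio_ge0. Qed.

(** The value [dreal r] of [density] only says that the upper density does not
exceed the lower one, and that the latter is [r]; as the ratios lie in [0,1],
this is convergence. *)
Lemma density_drealP A r : density R A = dreal r <-> ratio A @ \oo --> r.
Proof.
rewrite /density; split; last first.
  move=> Ar; have [li ls] := cvg_limn_inf_sup Ar.
  by rewrite /lower_density /upper_density li ls ltxx.
case: ltP => // ul [<-]; apply: bounded_cvg_limn_inf => //.
exists 1; split => // M M1 n _ /=.
by rewrite ger0_norm ?ratio_ge0// (le_trans (ratio_le1 A n))// ltW.
Qed.

Lemma density_oscP A : density R A = osc <-> forall r, ~ (ratio A @ \oo --> r).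
Proof.
split=> [dA r /density_drealP|H]; first by rewrite dA.
by case dA : (density R A) => [r|//]; have /density_drealP/H := dA.
Qed.
End Convergence.

(** * Infinite coinfinite sets *)

Lemma finite_nat_bounded (A : set nat) :
  finite_set A -> exists N, A `<=` `I_N.
Proof.
move=> fA; exists (\max_(i <- fset_set A) i).+1 => n An /=.
by rewrite ltnS; apply: leq_bigmax_seq => //; rewrite in_fset_set ?inE.
Qed.

Lemma infinite_nat_unbounded (A : set nat) N :
  infinite_set A -> exists2 n, A n & (N <= n)%N.
Proof.
move=> iA; apply: contrapT => H; apply: iA.
apply: sub_finite_set (finite_II N) => n An /=; rewrite ltnNge.
by apply/negP => Nn; apply: H; exists n.
Qed.

Lemma finite_image_inj (T U : Type) (f : T -> U) (A : set T) :
  injective f -> finite_set (f @` A) = finite_set A.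
Proof. by move=> fi; apply: eq_finite_set; apply: inj_card_eq; apply: in2W. Qed.

Lemma image_setC_bij (T U : Type) (p : T -> U) (A : set T) :
  bijective p -> p @` (~` A) = ~` (p @` A).
Proof.
move=> [q pK qK]; apply/seteqP; split => [_ [x nA <-]|y nA] /=.
  by move=> [z Az /(can_inj pK) zx]; apply: nA; rewrite -zx.
by exists (q y) => //= Aq; apply: nA; exists (q y).
Qed.

Lemma inf_coinfC A : inf_coinf A -> inf_coinf (~` A).
Proof. by move=> [iA iC]; split; rewrite ?setCK. Qed.

(** The sets [A] and [B] are equinumerous, and so are their complements; the
permutation is glued from a bijection on each side. *)
Lemma inf_coinf_image A B : inf_coinf A -> inf_coinf B ->
  exists2 p : nat -> nat, bijective p & p @` A = B.
Proof.
move=> [iA iCA] [iB iCB].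
have inf_bij C D : infinite_set C -> infinite_set D ->
    exists f : nat -> nat, set_bij C D f.
  move=> iC iD; apply/card_set_bijP; apply: (@card_eq_trans _ _ _ _ [set: nat]).
    exact: eq_card_nat.
  by rewrite card_eq_sym; apply: eq_card_nat => //; exact: countableP.
have [f [fAB f_inj f_surj]] := inf_bij _ _ iA iB.
have [g [gAB g_inj g_surj]] := inf_bij _ _ iCA iCB.
pose p n := if `[< A n >] then f n else g n.
have pA n : A n -> p n = f n by move=> An; rewrite /p asboolT.
have pC n : ~ A n -> p n = g n by move=> An; rewrite /p asboolF.
exists p; last first.
  apply/seteqP; split => [_ [x Ax <-]|y /f_surj[x Ax <-]].
    by rewrite pA//; exact: fAB.
  by exists x => //; rewrite pA.
rewrite -setTT_bijective; split => // [x y _ _|y _].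
  have [Ax|Ax] := pselect (A x); have [Ay|Ay] := pselect (A y).
  - by rewrite !pA//; apply: f_inj; rewrite inE.
  - rewrite pA// pC// => fg; exfalso.
    by apply: (gAB y Ay); rewrite -fg; exact: fAB.
  - rewrite pC// pA// => fg; exfalso.
    by apply: (gAB x Ax); rewrite fg; exact: fAB.
  - by rewrite !pC//; apply: g_inj; rewrite inE.
have [/f_surj[x Ax <-]|/g_surj[x Ax <-]] := pselect (B y).
  by exists x => //; rewrite pA.
by exists x => //; rewrite pC.
Qed.

(** * Densities of special sets *)

Section Witnesses.
Variable R : realType.
Implicit Types (A S : set nat) (r : R).
Local Notation ratio := (@initial_ratio R).
Local Notation density := (density R).

(** The effect of complementation on densities, see [densityC]. *)
Definition dcompl (z : dvalue R) : dvalue R :=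
  if z is dreal r then dreal (1 - r) else osc.

Lemma dcomplK : involutive dcompl.
Proof. by case => [r|] //=; rewrite subKr. Qed.

(** Ratios of complementary sets add up to 1.  If [A] has no density, neither
has its complement, since otherwise [A] would be the complement of a set with a
density. *)
Lemma densityC A : density (~` A) = dcompl (density A).
Proof.
have realC B r : density B = dreal r -> density (~` B) = dreal (1 - r).
  by move=> /density_drealP/cvg_ratioC/density_drealP.
case dA : (density A) => [r|] /=; first exact: realC.
case dC : (density (~` A)) => [r|//].
by have := realC _ _ dC; rewrite setCK dA.
Qed.

Lemma density_finite A : finite_set A -> density A = dreal 0.
Proof. by move=> /(@cvg_ratio_finite R)/density_drealP. Qed.

Lemma density_inf_coinf A :
  density A <> dreal 0 -> density A <> dreal 1 -> inf_coinf A.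
Proof.
move=> d0 d1; split; first by move=> /density_finite.
move=> /density_finite; rewrite densityC => /(congr1 dcompl).
by rewrite dcomplK /= subr0.
Qed.

(** The increments of [n |-> floor (n * r)] are 0 or 1 when [0 <= r <= 1]; the
set collects the places where the increment is 1, so that its initial count is
[floor (n * r)]. *)
Definition beatty r : set nat :=
  [set n | (Num.truncn (n%:R * r) < Num.truncn (n.+1%:R * r))%N].

Lemma density_beatty r : 0 <= r <= 1 -> density (beatty r) = dreal r.
Proof.
move=> /andP[r0 r1]; apply/density_drealP.
have countE n : initial_count (beatty r) n = Num.truncn (n%:R * r).
  elim: n => [|n IHn]; first by rewrite initial_count0 mul0r truncn0.
  rewrite initial_countS IHn; case: asboolP; rewrite /beatty /= => H.
    apply/eqP; rewrite addn1 eqn_leq H/= -ltnS truncn_lt_nat ?mulr_ge0//.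
    have := truncnS_gt (n%:R * r); rewrite -!natr1.
    lra.
  move/negP: H; rewrite -leqNgt => H.
  apply/eqP; rewrite addn0 eqn_leq H andbT; apply: le_truncn.
  by rewrite ler_wpM2r// ler_nat.
apply: cvg_ratioP => m; exists m%:R => n; rewrite countE.
have /truncn_itv/andP[lo hi] : 0 <= n%:R * r by rewrite mulr_ge0.
have m0 : 0 <= m%:R :> R by [].
have n0 : 0 <= n%:R :> R by [].
rewrite ler0_norm ?subr_le0// opprB.
rewrite -natr1 in hi.
nra.
Qed.

Definition squares_of S : set nat := (fun k => k * k)%N @` S.

Lemma square_inj : injective (fun k => k * k)%N.
Proof. by move=> x y /= /eqP; rewrite !mulnn eqn_sqr => /eqP. Qed.

(** An element [k * k < n] has [k < m] or [k <= n / m], so the initial count is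
at most [m + n / m + 1], for every [m]. *)
Lemma density_squares S : density (squares_of S) = dreal 0.
Proof.
apply/density_drealP; apply: cvg_ratioP => m; exists (m * (m + 1))%:R => n.
rewrite mulr0 subr0 ger0_norm// -natrM -natrD ler_nat.
have [->|m0] := posnP m; first by rewrite muln0.
have : (initial_count (squares_of S) n <= (m + n %/ m).+1)%N.
  apply: (@initial_count_image _ (fun k => k * k)%N) => _ [[k _ <-] /= kn].
  exists k => //=.
  have [km|mk] := ltnP k m; first by rewrite ltnS ltnW// (leq_trans km) ?leq_addr.
  suff : (k <= n %/ m)%N by lia.
  by rewrite leq_divRL// (leq_trans _ (ltnW kn))// leq_mul2l mk orbT.
have := leq_divM n m; nia.
Qed.

(** The union of the blocks from [2 ^ k] to [2 ^ k.+1 - 1] for [k] in [S]; the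
element 0 is added when 0 is in [S], since [trunc_log 2 0 = 0]. *)
Definition log_blocks S : set nat := trunc_log 2 @^-1` S.

Lemma log_blocks_count S k :
  initial_count (log_blocks S) (2 ^ k.+1) =
  (initial_count (log_blocks S) (2 ^ k) + `[< S k >] * 2 ^ k)%N.
Proof.
suff H j : (j <= 2 ^ k)%N -> initial_count (log_blocks S) (2 ^ k + j) =
    (initial_count (log_blocks S) (2 ^ k) + `[< S k >] * j)%N.
  by rewrite expnS mul2n -addnn H.
elim: j => [|j IHj] jk; first by rewrite muln0 !addn0.
rewrite addnS initial_countS IHj; last exact: ltnW.
have -> : log_blocks S (2 ^ k + j)%N = S k.
  rewrite /log_blocks /= (@trunc_log_eq _ k)// leq_addr expnS mul2n -addnn.
  by rewrite ltn_add2l.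
by rewrite mulnS addnAC addnA.
Qed.

(** By [log_blocks_count] the ratio [u k] at [2 ^ k] satisfies
[2 * u k.+1 - u k = 1] if [k] is in [S], and [= 0] otherwise.  If the ratios
converged, so would this sequence, but it takes both values infinitely often. *)
Lemma density_log_blocks S : inf_coinf S -> density (log_blocks S) = osc.
Proof.
move=> [iS iCS]; apply/density_oscP => r br.
pose u k := ratio (log_blocks S) (2 ^ k)%N.
have ur : u @ \oo --> r.
  apply: (cvg_comp (fun k => 2 ^ k)%N _ _ br).
  apply/cvgnyPge => n; near=> k.
  by rewrite (leq_trans _ (ltnW (ltn_expl k _)))//; near: k; exact: nbhs_infty_ge.
have u_rec k : 2 * u k.+1 - u k = `[< S k >]%:R.
  rewrite /u !ratioE log_blocks_count natrD natrM expnS natrM.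
  have k0 : (2 ^ k)%:R != 0 :> R by rewrite pnatr_eq0 -lt0n expn_gt0.
  by field; rewrite k0.
have : (fun k => 2 * u k.+1 - u k) @ \oo --> 2 * r - r.
  apply: cvgB => //; apply: cvgMr.
  by move: ur; rewrite -cvg_shiftS.
under eq_fun do rewrite u_rec.
rewrite (_ : 2 * r - r = r); last by ring.
move=> /cvgrPdist_lt/(_ (1/2)) [|N _ HN]; first by lra.
have [k Sk /HN] := infinite_nat_unbounded _ N iS.
have [l Sl /HN] := infinite_nat_unbounded _ N iCS.
rewrite (asboolT Sk) (asboolF Sl) /= !ltr_norml => /andP[? ?] /andP[? ?].
lra.
Unshelve. all: by end_near. Qed.
End Witnesses.

Section Realization.
Variable R : realType.
Implicit Types (A S : set nat) (z : dvalue R).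
Local Notation density := (density R).

Lemma dreal10 : dreal (1 : R) <> dreal 0.
Proof. by move=> [] /eqP; rewrite oner_eq0. Qed.

Lemma inf_coinf_squares S : infinite_set S -> inf_coinf (squares_of S).
Proof.
move=> iS; split; first by rewrite finite_image_inj//; exact: square_inj.
move=> /(density_finite R); rewrite densityC density_squares /= subr0.
exact: dreal10.
Qed.

Lemma inf_coinf_log_blocks S : inf_coinf S -> inf_coinf (log_blocks S).
Proof.
by move=> /(density_log_blocks R) dS; apply: (density_inf_coinf R); rewrite dS.
Qed.

(** The Beatty set of [1 / 2] serves as an infinite coinfinite set of blocks for
the value osc. *)
Lemma density_realized z : all_dvalues z ->
  exists2 A, inf_coinf A & density A = z.
Proof.
have sq : inf_coinf (squares_of setT) /\ density (squares_of setT) = dreal 0.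
  split; last exact: density_squares.
  by apply: inf_coinf_squares; exact: infinite_nat.
have beattyP r : 0 <= r <= 1 -> r <> 0 -> r <> 1 -> inf_coinf (beatty R r).
  by move=> r01 r0 r1; apply: (density_inf_coinf R);
    rewrite density_beatty// => -[].
case=> [->|[r r01 ->]].
  have half : inf_coinf (beatty R (1 / 2)).
    by apply: beattyP; [apply/andP; split; lra|lra|lra].
  exists (log_blocks (beatty R (1 / 2))); first exact: inf_coinf_log_blocks.
  exact: density_log_blocks.
have [->|r0] := pselect (r = 0); first by exists (squares_of setT); case: sq.
have [->|r1] := pselect (r = 1).
  exists (~` squares_of setT); first by apply: inf_coinfC; case: sq.
  by rewrite densityC sq.2 /= subr0.
by exists (beatty R r); [exact: beattyP|exact: density_beatty].
Qed.
End Realization.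

(** * Almost disjoint families *)

Definition almost_disjoint {I : Type} (F : I -> set nat) : Prop :=
  forall i j, i <> j -> finite_set (F i `&` F j).

Lemma almost_disjoint_image (I : Type) (F : I -> set nat) (p : nat -> nat) :
  injective p -> almost_disjoint F -> almost_disjoint (fun i => p @` F i).
Proof.
move=> p_inj adF i j ij; apply: sub_finite_set (finite_image p (adF i j ij)).
by move=> _ [[x Fx <-] [y Fy /p_inj yx]]; exists x => //; rewrite -yx in Fx *.
Qed.

(** The set of the codes of the finite initial segments of the characteristic
sequence of [a], that is, a branch of the binary tree with coded nodes. *)
Definition branch (a : set nat) : set nat :=
  range (fun n => choice.pickle [seq `[< a i >] | i <- iota 0 n]).

Lemma branch_infinite a : infinite_set (branch a).
Proof.
rewrite finite_image_inj; first exact: infinite_nat.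
move=> n m /(pcan_inj choice.pickleK) /(congr1 size).
by rewrite !size_map !size_iota.
Qed.

(** Once [a] and [b] differ at [i], they have no initial segment of length
greater than [i] in common. *)
Lemma branch_almost_disjoint : almost_disjoint branch.
Proof.
move=> a b ab.
have [i abi] : exists i, `[< a i >] <> `[< b i >].
  apply: contrapT => H; apply: ab; apply/funext => i.
  apply: contrapT => abi; apply: H; exists i => abE; apply: abi.
  by rewrite -(asboolE (a i)) abE asboolE.
apply: sub_finite_set (finite_image (fun n => choice.pickle [seq `[< a i >] | i <- iota 0 n])
  (finite_II i.+1)) => _ [[n _ <-] [m _ /(pcan_inj choice.pickleK) mn]].
exists n => //=; rewrite ltnS leqNgt; apply/negP => ltin; apply: abi.
have nm : m = n by move: (congr1 size mn); rewrite !size_map !size_iota.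
rewrite nm in mn; move: (congr1 (fun s => nth true s i) mn).
by rewrite !(nth_map 0%N) ?size_iota// nth_iota.
Qed.

(** The complement is infinite because it contains almost all of the branch of
[~` a]. *)
Lemma inf_coinf_branch a : inf_coinf (branch a).
Proof.
split; first exact: branch_infinite.
move=> fC; apply: (@branch_infinite (~` a)).
have fI : finite_set (branch (~` a) `&` branch a).
  apply: branch_almost_disjoint => /(congr1 (fun s : set nat => s 0%N)) aE.
  have [a0|a0] := pselect (a 0%N); last by apply: (a0); rewrite -aE.
  by have := a0; rewrite -aE; apply.
apply: (@sub_finite_set _ _ ((branch (~` a) `&` branch a) `|` ~` branch a)).
  by move=> n bn; have [an|an] := pselect (branch a n); [left|right].
by rewrite finite_setU.
Qed.

Section Countability.
Variable R : realType.
Local Notation ratio := (@initial_ratio R).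
Local Notation density := (density R).

(** Additivity of densities over a finite almost disjoint family, recorded as a
lower bound so that no choice of the limits is needed. *)
Lemma ratio_bigU_ge (I : choiceType) (F : I -> set nat) (c : R) (s : seq I) :
  almost_disjoint F -> uniq s ->
  (forall i, i \in s -> exists2 r, c <= r & ratio (F i) @ \oo --> r) ->
  exists2 r, (size s)%:R * c <= r &
             ratio (\big[setU/set0]_(i <- s) F i) @ \oo --> r.
Proof.
move=> adF; elim: s => [_ _|i s IHs /= /andP[is_ us] Fs].
  by exists 0; rewrite ?mul0r// big_nil; exact: cvg_ratio_finite.
have [r cr Fi] := Fs i (mem_head _ _).
have [t ct Ft] : exists2 t, (size s)%:R * c <= t &
    ratio (\big[setU/set0]_(i <- s) F i) @ \oo --> t.
  by apply: IHs => // j js; apply: Fs; rewrite inE js orbT.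
exists (r + t); first by rewrite -natr1 mulrDl mul1r addrC lerD.
rewrite big_cons; apply: cvg_ratioU => //.
elim: (s) is_ => [_|j s' IHs']; first by rewrite big_nil setI0.
rewrite inE negb_or big_cons setIUr finite_setU => /andP[/eqP ij /IHs' ?].
by split => //; exact: adF.
Qed.

(** If infinitely many members had density at least [1 / m], the union of
[m + 1] of them would have density greater than 1. *)
Lemma countable_real_density (I : Type) (F : I -> set nat) :
  almost_disjoint F ->
  countable [set i | exists2 r, r <> 0 & density (F i) = dreal r].
Proof.
elim/Pchoice: I => I in F * => adF.
pose D m := [set i | exists2 r : R, m.+1%:R^-1 <= r & ratio (F i) @ \oo --> r].
have -> : [set i | exists2 r, r <> 0 & density (F i) = dreal r] =
    \bigcup_m D m.
  apply/seteqP; split => [i [r r0 /density_drealP Fr]|i [m _ [r mr Fr]]].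
    have rgt0 : 0 < r by rewrite lt0r (cvg_ratio_ge0 _ _ _ Fr) andbT; exact/eqP.
    exists (Num.truncn r^-1) => //; exists r => //.
    by rewrite invf_ple ?posrE//; apply/ltW/truncnS_gt.
  exists r; last exact/density_drealP.
  move=> r0; have : 0 < m.+1%:R^-1 :> R by rewrite invr_gt0.
  by rewrite ltNge; rewrite r0 in mr; rewrite mr.
apply: bigcup_countable => // m _; apply: finite_set_countable.
apply: contrapT => /(@infinite_set_fset _ _ m.+2)[B BD mB].
have [|r le_r Br] := @ratio_bigU_ge _ F m.+1%:R^-1 (enum_fset B) adF (fset_uniq B).
  by move=> i iB; exact: BD.
have /(le_trans le_r) := cvg_ratio_le1 _ _ _ Br.
rewrite ler_pdivrMr// mul1r ler_nat => Bm.
by have := leq_trans mB Bm; rewrite ltnn.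
Qed.
End Countability.

(** Cantor's diagonal argument. *)
Lemma uncountable_set_nat : ~ countable [set: set nat].
Proof.
move=> /countable_injP[f f_inj].
pose D := [set f S | S in [set S : set nat | ~ S (f S)]].
have nDD : ~ D (f D).
  move=> /[dup] DD [S nSS fSD]; apply: nSS.
  by rewrite (f_inj S D _ _ fSD) ?inE.
by apply: (nDD); exists D.
Qed.

(** * The reduction *)

Section Reduction.
Variable R : realType.
Implicit Types X Y : set (dvalue R).
Local Notation density := (density R).

(** The condition on a family of challenges under which sending each permutation
to the set of challenges that it meets is half of a Tukey reduction. *)
Definition countably_met X Y (F : set nat -> set nat) : Prop :=
  (forall a, inf_coinf (F a) /\ X (density (F a))) /\
  forall p : nat -> nat, bijective p ->
    countable [set a | Y (density (p @` F a)) /\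
                       density (p @` F a) <> density (F a)].

(** Taking complements commutes with the action of a permutation and acts on
densities by the injection [dcompl], so a family for [X] and [Y] may be sought
after applying [dcompl] to both. *)
Lemma countably_metC X Y F :
  countably_met (@dcompl R @^-1` X) (@dcompl R @^-1` Y) F ->
  countably_met X Y (fun a => ~` F a).
Proof.
move=> [FX FY]; split => [a|p p_bij].
  have [Fa XFa] := FX a.
  by split; [exact: inf_coinfC|rewrite densityC].
apply: sub_countable (FY p p_bij); apply: subset_card_le => a /=.
by rewrite image_setC_bij// !densityC => -[? ne]; split => // /(congr1 (@dcompl R)).
Qed.

Lemma countably_met_almost_disjoint X Y F z :
  almost_disjoint F -> (forall a, inf_coinf (F a) /\ density (F a) = z) ->
  X z -> (forall y, Y y -> y <> z -> exists2 r, r <> 0 & y = dreal r) ->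
  countably_met X Y F.
Proof.
move=> adF Fz Xz Yz; split=> [a|p p_bij].
  by have [? ->] := Fz a.
have adpF := almost_disjoint_image _ _ _ (bij_inj p_bij) adF.
apply: sub_countable (countable_real_density R _ _ adpF).
by apply: subset_card_le => a /= [Ya]; rewrite (Fz a).2; exact: Yz.
Qed.

(** In either case a value in [Y] different from the common density of the
family is real and nonzero, by the choice of that density. *)
Lemma countably_met_exists X Y :
  (X (dreal 0) /\ ~ Y osc) \/ (X osc /\ ~ Y (dreal 0)) ->
  exists F, countably_met X Y F.
Proof.
case=> [[X0 Yosc]|[Xosc Y0]].
  exists (squares_of \o branch).
  apply: (@countably_met_almost_disjoint _ _ _ (dreal 0)) => //.
  - exact: almost_disjoint_image _ _ _ square_inj branch_almost_disjoint.
  - move=> a; split; last exact: density_squares.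
    by apply: (inf_coinf_squares R); exact: branch_infinite.
  - by move=> [r|//] _ r0; exists r => // rE; apply: r0; rewrite rE.
exists (log_blocks \o branch).
apply: (@countably_met_almost_disjoint _ _ _ osc) => //.
- move=> a b /branch_almost_disjoint /finite_nat_bounded[N abN].
  apply: sub_finite_set (finite_II (2 ^ N)%N) => n /abN /= nN.
  by apply: (leq_trans (@trunc_log_ltn 2 n _)) => //; rewrite leq_exp2l.
- move=> a; have bra := inf_coinf_branch a.
  by split; [exact: (inf_coinf_log_blocks R)|exact: density_log_blocks].
- by move=> [r|//] Yr _; exists r => // rE; apply: Y0; rewrite -rE.
Qed.

Lemma mem_countable_relational (K : Type) :
  [set: K] #= [set: set nat] -> relational_system (mem_countable K).
Proof.
move=> /eq_countable cK; split=> [k|[C cC] /=].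
  by exists (exist (fun C : set K => countable C) _ (countable1 k)).
apply: contrapT => H; apply: uncountable_set_nat; rewrite -cK.
apply: sub_countable cC; apply: subset_card_le => k _.
by apply: contrapT => Ck; apply: H; exists k.
Qed.

(** The reduction sends [k] to [F (f k)], where [f] injects [K] into the sets of
naturals.  It also yields a challenge unmet by a given permutation [p], namely
the image of a point outside the countable set assigned to [p]. *)
Lemma tukey_le_countably_met (K : Type) X Y F :
  [set: K] #= [set: set nat] ->
  Y `<=` @all_dvalues R -> (forall x, X x -> exists y, Y y /\ y <> x) ->
  countably_met X Y F -> tukey_le (mem_countable K) (density_system X Y).
Proof.
move=> cK Yall XY [FX FY].
have [f f_inj] : exists f : K -> set nat, injective f.
  have /card_eqPle[/pcard_injP[f f_inj] _] := cK.
  by exists f => x y; apply: f_inj; rewrite inE.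
pose challenge k : chal (density_system X Y) := 
    exist (fun A => inf_coinf A /\ X (density A)) (F (f k)) (FX (f k)).
have answers_countable (p : resp (density_system X Y)) :
    countable [set k | Defs.meets (challenge k) p].
  rewrite -(eq_countable (inj_card_eq (in2W f_inj))).
  apply: sub_countable (FY _ (svalP p)); apply: subset_card_le.
  by move=> _ [k kp <-].
pose answers p : resp (mem_countable K) := exist (fun C : set K => countable C) _ (answers_countable p).
have relK := mem_countable_relational _ cK.
split=> //; last by exists challenge, answers.
split=> [[A [Ainf XA]]|p].
  have [y [Yy yA]] := XY _ XA.
  have [B Binf By] := density_realized _ _ (Yall _ Yy).
  have [p p_bij pAB] := inf_coinf_image _ _ Ainf Binf.
  by exists (exist _ p p_bij); rewrite /= pAB By.
by have [k nk] := relK.2 (answers p); exists (challenge k).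
Qed.
End Reduction.

Theorem theorem24 (R : realType) (K : Type)
    (K_continuum : [set: K] #= [set: set nat])
    (X Y : set (dvalue R))
    (X_all : X `<=` @all_dvalues R) (Y_all : Y `<=` @all_dvalues R)
    (X_nonempty : X !=set0)
    (XY : forall x, X x -> exists y, Y y /\ y <> x)
    (cases : ((X (dreal 0) \/ X (dreal 1)) /\ ~ Y osc) \/
             (X osc /\ (~ Y (dreal 0) \/ ~ Y (dreal 1)))) :
  tukey_le (mem_countable K) (density_system X Y).
Proof.
suff [F F_met] : exists F, countably_met R X Y F.
  exact: tukey_le_countably_met K_continuum Y_all XY F_met.
(* Sorted by whether the value 0 or its complementary value 1 is involved. *)
have [direct|dual] :
    ((X (dreal 0) /\ ~ Y osc) \/ (X osc /\ ~ Y (dreal 0))) \/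
    ((X (dreal 1) /\ ~ Y osc) \/ (X osc /\ ~ Y (dreal 1))) by tauto.
  exact: countably_met_exists.
have [|F F_met] := countably_met_exists R (@dcompl R @^-1` X) (@dcompl R @^-1` Y).
  by rewrite /= subr0.
by exists (fun a => ~` F a); exact: countably_metC.
Qed.
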